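(* Let $s\ge 3$ be an odd integer, and let $K^-$ be the cyclic $\mathbb{Z}_4$-linear code of length $n=2^s-1$ given by $$K^-=\{(\mathrm{Tr}(a\xi^t))_{0\le t\le 2^s-2} : a\in \mathrm{GR}(4,s)\}.$$ Then the syndrome graph (coset graph) associated with $K^-$, namely the coset graph of the dual code $(K^-)^\bot$, with a double loop added at each vertex, is a $3$-SWRG.
   Context: $\mathrm{GR}(4,s)$ is the Galois ring of characteristic $4$ with $4^s$ elements, $\xi\in\mathrm{GR}(4,s)$ is an element of multiplicative order $2^s-1$, and $\mathrm{Tr}:\mathrm{GR}(4,s)\to\mathbb{Z}_4$ is the trace map. ($K^-$ is the free part $Q$ of the quaternary Kerdock code $K=\mathbb{Z}_4\mathbf{j}\oplus Q$ of length $2^s$, punctured at the coordinate on which $Q$ vanishes, with $\mathbf{j}$ the all-one vector.) The coset graph of a $\mathbb{Z}_4$-linear code $C\subseteq\mathbb{Z}_4^n$ has as vertices the cosets of $C$ in $\mathbb{Z}_4^n$; two cosets are adjacent iff their difference is a coset $ue_i+C$ with $u\in\{1,3\}$ and $e_i$ a standard unit vector. The dual code is taken with respect to the standard inner product. A graph (possibly with loops) is a $3$-SWRG (strongly walk-regular graph) if there are integers $\lambda,\mu,\nu$ such that the number of walks of length $3$ from $x$ to $y$ is $\lambda$ if $x\neq y$ are adjacent, $\mu$ if $x\ne y$ are non-adjacent, and $\nu$ if $x=y$. *)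

(* Defs.v *)
From mathcomp Require Import all_boot all_order all_algebra.

Set Implicit Arguments.
Unset Strict Implicit.
Unset Printing Implicit Defensive.

Import GRing.Theory.
Local Open Scope ring_scope.

(* The Galois ring GR(4, s), characterised among finite commutative rings in   *)
(* the usual intrinsic way: characteristic 4, 4 ^ s elements, and the zero     *)
(* divisors together with 0 form the ideal generated by 2 (for 0 take y := 1). *)
Definition is_GR4 (s : nat) (R : finComNzRingType) : Prop :=
  [/\ forall m : nat, (m%:R == 0 :> R) = (4 %| m)%N,
      #|R| = (4 ^ s)%N
    & forall x : R, (exists2 y : R, y != 0 & x * y = 0) <->
                    (exists z : R, x = 2%:R * z)].

Section Trace.
Variables (s : nat) (R : finComNzRingType).

(* In GR(4, s) this is {0} together with the powers of an element of order     *)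
(* 2 ^ s - 1.                                                                  *)
Definition teichmuller : {set R} := [set x | x ^+ (2 ^ s) == x].

(* In GR(4, s) every a is uniquely a0 + 2 a1 with a0, a1 Teichmuller, and the  *)
(* Frobenius automorphism maps it to a0 ^ 2 + 2 a1 ^ 2; the default value 0 of *)
(* the choice is not used.                                                     *)
Definition frobenius (a : R) : R :=
  odflt 0 [pick b : R |
    [exists a0 in teichmuller, exists a1 in teichmuller,
       (a == a0 + 2%:R * a1) && (b == a0 ^+ 2 + 2%:R * a1 ^+ 2)]].

Definition traceR (a : R) : R := \sum_(i < s) iter i frobenius a.

(* In GR(4, s), traceR takes its values in the prime subring {0, 1, 2, 3},     *)
(* which is identified here with 'Z_4.                                         *)
Definition trace (a : R) : 'Z_4 :=
  odflt 0 [pick k : 'Z_4 | (k : nat)%:R == traceR a].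

Definition Kminus (xi : R) : {set 'rV['Z_4]_(2 ^ s - 1)} :=
  [set \row_(t < 2 ^ s - 1) trace (a * xi ^+ t) | a : R].

End Trace.

Section CosetGraph.
Variable n : nat.
Implicit Types C : {set 'rV['Z_4]_n}.

Definition dual_code C : {set 'rV['Z_4]_n} :=
  [set v : 'rV_n | [forall c in C, \sum_i v 0 i * c 0 i == 0]].

Definition code_coset C (v : 'rV['Z_4]_n) : {set 'rV['Z_4]_n} :=
  [set v + c | c in C].

Definition code_cosets C : {set {set 'rV['Z_4]_n}} :=
  [set code_coset C v | v : 'rV['Z_4]_n].

Definition coset_vertex C : finType :=
  {X : {set 'rV['Z_4]_n} | X \in code_cosets C}.

Definition coset_adj C (X Y : coset_vertex C) : bool :=
  [exists u : 'Z_4, exists i : 'I_n,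
     (u \in [:: 1; 3%:R]) &&
     ([set x - y | x in val X, y in val Y] ==
        code_coset C (u *: delta_mx 0 i))].

End CosetGraph.

(* A graph with possible loops and multiple edges on a finite vertex type T is *)
(* given by its multiplicity function m : T -> T -> nat; a loop at x           *)
(* contributes 1 to m x x.                                                     *)
Fixpoint nwalks (T : finType) (m : T -> T -> nat) (l : nat) (x y : T) : nat :=
  if l is l'.+1 then (\sum_(z : T) m x z * nwalks m l' z y)%N else (x == y).

Definition is_SWRG (l : nat) (T : finType) (m : T -> T -> nat) : Prop :=
  exists lambda mu nu : int, forall x y : T,
    (nwalks m l x y)%:Z =
      if x == y then nu else if (0 < m x y)%N then lambda else mu.

Definition add_loops (k : nat) (T : finType) (e : rel T) (x y : T) : nat :=
  (e x y + k * (x == y))%N.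

(* Main.v *)
Require Import Defs.
From mathcomp Require Import all_boot all_order all_algebra.
From mathcomp Require Import ring zify.

Set Implicit Arguments.
Unset Strict Implicit.
Unset Printing Implicit Defensive.

Import GRing.Theory.
(** The graph is a Cayley graph on the additive group of R = GR(4, s).  Since
    the trace form is nondegenerate ([traceR_nondegenerate]), a vector v lies in
    the dual of K^- iff its syndrome, the sum of the v_i xi^i, vanishes; so the
    cosets are in bijection with R ([vertex_syndrome_bij]), and two of them are
    adjacent iff the difference of their syndromes is a power of xi or the
    opposite of one.  Let T be the Teichmuller set, that is, 0 and the powers of
    xi.  As 0 belongs to T and to -T, the double loop is exactly what turns the
    connection multiset into T + (-T) ([add_loops_cayley]).

    Write T^- for -T and use the same letters for the elements of the integral
    group ring of (R, +).  Two identities hold there, P being the ideal 2R: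

    - T T^- = 2^s [0] + R - P   ([diff_countE]): a difference of two distinct
      elements of T determines them, and it never lies in P;
    - T^2 + (T^-)^2 = 2 R when s is odd   ([sum_countNE]): a sum of two elements
      of T determines the unordered pair, and x + y = -(z + w) inside T forces
      x = y = z = w.

    In both cases uniqueness gives an upper bound for every coefficient, and
    since the total of the coefficients is |T|^2 = 4^s, respectively
    2 |T|^2, all the bounds are attained: existence of the representations
    comes for free.  Hence (T + T^-)^2 = 2^(s+1) [0] + 4 R - 2 P.  As T meets
    every coset of P once, (T + T^-) P = 2 R, and therefore
    (T + T^-)^3 = 2^(s+1) (T + T^-) + (8 2^s - 4) R   ([kerdock_cayley_walk3]),
    which is the strong walk-regularity for walks of length 3.

    The parity of s enters through the residue field R / 2R: for odd s it has no
    primitive cube root of unity, so x^2 + x y + y^2 vanishes only trivially.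
    Congruence modulo 2 is expressed throughout as equality of doubles,
    2 a = 2 b, which is the same thing because the annihilator of 2 is 2R. *)

Local Open Scope ring_scope.

Lemma nwalks_bij (V W : finType) (f : V -> W) (m : W -> W -> nat)
    (m' : V -> V -> nat) (l : nat) (x y : V) : bijective f ->
  (forall x y, m' x y = m (f x) (f y)) ->
  nwalks m' l x y = nwalks m l (f x) (f y).
Proof.
move=> f_bij mE; elim: l x => [|l IH] x /=; first by rewrite (bij_eq f_bij).
rewrite [RHS](reindex f) /=; last exact: onW_bij.
by apply: eq_bigr => z _; rewrite mE IH.
Qed.

Section GaloisRing.

Variables (s : nat) (R : finComNzRingType) (xi : R).
Hypotheses (s_gt0 : (0 < s)%N) (hR : is_GR4 s R).
Hypothesis hxi : (2 ^ s - 1).-primitive_root xi.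

Local Notation T := (teichmuller s R).
Local Notation phi := (@frobenius s R).
Local Notation q := (2 ^ s.-1)%N.

(** * Arithmetic modulo 2 *)

Lemma GR4_four0 : 4%:R = 0 :> R.
Proof. by have [h _ _] := hR; apply/eqP; rewrite h. Qed.

Lemma GR4_four x : 4%:R * x = 0 :> R.
Proof. by rewrite GR4_four0 mul0r. Qed.

Lemma GR4_two_neq0 : 2%:R != 0 :> R.
Proof. by have [h _ _] := hR; rewrite h. Qed.

Lemma zero_div_dbl (x y : R) : y != 0 -> x * y = 0 -> 2%:R * x = 0.
Proof.
have [_ _ h] := hR => y0 xy; have [z ->] := (h x).1 (ex_intro2 _ _ y y0 xy).
by rewrite mulrA -natrM GR4_four.
Qed.

Lemma dbl_eq0_half (x : R) : 2%:R * x = 0 -> exists z, x = 2%:R * z.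
Proof.
have [_ _ h] := hR => x2; apply/h; exists 2%:R; first exact: GR4_two_neq0.
by rewrite mulrC.
Qed.

Lemma dbl_reg (x y : R) : 2%:R * x != 0 -> x * y = 0 -> y = 0.
Proof.
move=> x2 xy; apply/eqP; apply: contraNT x2 => y0.
by rewrite (zero_div_dbl y0 xy).
Qed.

Lemma dbl_prime (x y : R) :
  2%:R * (x * y) = 0 -> 2%:R * x = 0 \/ 2%:R * y = 0.
Proof.
move=> h; have [|x2] := eqVneq (2%:R * x) 0; first by left.
by right; apply: (dbl_reg x2); rewrite -h mulrCA.
Qed.

(** Squaring kills the ambiguity modulo 2:
    (b + 2 z)^2 = b^2 + 4 (b z + z^2). *)
Lemma dbl_sqr (a b : R) : 2%:R * a = 2%:R * b -> a ^+ 2 = b ^+ 2.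
Proof.
move=> ab; have [|z hz] := @dbl_eq0_half (a - b).
  by rewrite mulrBr ab subrr.
have -> : a = b + 2%:R * z by rewrite -hz addrC subrK.
transitivity (b ^+ 2 + 4%:R * (b * z + z ^+ 2)); first by ring.
by rewrite GR4_four addr0.
Qed.

Lemma dbl_expn (a b : R) k :
  2%:R * a = 2%:R * b -> 2%:R * a ^+ k = 2%:R * b ^+ k.
Proof.
move=> ab; elim: k => [//|k IH].
by rewrite !exprS mulrCA IH mulrCA mulrA ab -mulrA.
Qed.

Lemma dbl_pow2 (a b : R) k :
  (0 < k)%N -> 2%:R * a = 2%:R * b -> a ^+ (2 ^ k) = b ^+ (2 ^ k).
Proof.
by case: k => // k _ /dbl_sqr ab; rewrite expnS !exprM ab.
Qed.

(** Iterated squaring is additive up to one cross term: the square of that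
    cross term, and its products with the main terms, carry a factor 4. *)
Lemma pow2_add (x y : R) k :
  (x + y) ^+ (2 ^ k.+1) =
  x ^+ (2 ^ k.+1) + y ^+ (2 ^ k.+1) + 2%:R * (x * y) ^+ (2 ^ k).
Proof.
elim: k => [|k IH]; first by rewrite expn0 expn1 expr1 mulr_natl sqrrD addrAC.
rewrite expnSr exprM IH.
have -> : x ^+ (2 ^ k.+1 * 2) = (x ^+ (2 ^ k.+1)) ^+ 2 by rewrite exprM.
have -> : y ^+ (2 ^ k.+1 * 2) = (y ^+ (2 ^ k.+1)) ^+ 2 by rewrite exprM.
rewrite [(x * y) ^+ (2 ^ k.+1)]exprMn.
set X := x ^+ _; set Y := y ^+ _; set Z := _ ^+ (2 ^ k).
transitivity (X ^+ 2 + Y ^+ 2 + 2%:R * (X * Y)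
   + 4%:R * (Z ^+ 2 + X * Z + Y * Z)); first by ring.
by rewrite GR4_four addr0.
Qed.

Lemma dbl_pow2_add (x y : R) k :
  2%:R * (x + y) ^+ (2 ^ k) = 2%:R * (x ^+ (2 ^ k) + y ^+ (2 ^ k)).
Proof.
case: k => [//|k]; rewrite pow2_add [LHS]mulrDr.
by rewrite [X in _ + X]mulrA -natrM GR4_four addr0.
Qed.

(** * The Teichmuller set and the decomposition a0 + 2 a1 *)

Lemma teichE x : (x \in T) = (x ^+ (2 ^ s) == x).
Proof. by rewrite inE. Qed.

Lemma teich_pow x : x \in T -> x ^+ (2 ^ s) = x.
Proof. by rewrite teichE => /eqP. Qed.

Lemma teich0 : 0 \in T.
Proof. by rewrite teichE expr0n expn_eq0. Qed.

Lemma teich1 : 1 \in T.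
Proof. by rewrite teichE expr1n. Qed.

Lemma teichM x y : x \in T -> y \in T -> x * y \in T.
Proof. by rewrite !teichE exprMn => /eqP-> /eqP->. Qed.

Lemma teichX x k : x \in T -> x ^+ k \in T.
Proof. by rewrite !teichE exprAC => /eqP->. Qed.

Lemma teich_inj a b : a \in T -> b \in T -> 2%:R * a = 2%:R * b -> a = b.
Proof.
by move=> /teich_pow {2}<- /teich_pow {2}<-; apply: dbl_pow2.
Qed.

Lemma teich_q x : x \in T -> (x ^+ q) ^+ 2 = x.
Proof. by move=> xT; rewrite -exprM -expnSr prednK // teich_pow. Qed.

Lemma teich_add_pow x y : x \in T -> y \in T ->
  (x + y) ^+ (2 ^ s) = x + y + 2%:R * (x * y) ^+ q.
Proof.
move=> xT yT; have := pow2_add x y s.-1.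
by rewrite prednK // (teich_pow xT) (teich_pow yT).
Qed.

Definition even_part : {set R} := [set x | 2%:R * x == 0].

(** Doubling has kernel 2R and image 2R, so |R| = |2R|^2. *)
Lemma card_even_part : #|even_part| = (2 ^ s)%N.
Proof.
have [_ hc _] := hR.
apply/eqP; rewrite -(eqn_exp2r _ _ (ltn0Sn 1)) -expnM mulnC expnM -hc; apply/eqP.
rewrite -[RHS]sum1_card.
rewrite (partition_big (fun x : R => 2%:R * x) (mem even_part)) /=; last first.
  by move=> x _; rewrite inE mulrA -natrM GR4_four.
rewrite (eq_bigr (fun=> #|even_part|)); last first.
  move=> y; rewrite inE => /eqP/dbl_eq0_half[z ->].
  rewrite -sum1_card (reindex_inj (addrI z)) /=; apply: eq_bigl => x.
  rewrite !inE mulrDr; apply/eqP/eqP => [|->]; last exact: addr0.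
  by rewrite -{2}[2%:R * z]addr0 => /addrI.
by rewrite sum_nat_const mulnn.
Qed.

(** Since elements of T are distinct modulo 2, this injection bounds |T| by
    4^s / 2^s; the powers of xi show that the bound is reached. *)
Lemma teich_even_inj :
  {in setX T even_part &, injective (fun u : R * R => u.1 + u.2)}.
Proof.
move=> [a p] [b r]; rewrite !in_setX /= => /andP[aT].
rewrite inE => /eqP p0 /andP[bT]; rewrite inE => /eqP r0 e.
have ab : a = b.
  by apply: teich_inj => //; rewrite -[LHS]addr0 -p0 -mulrDr e mulrDr r0 addr0.
by move: e; rewrite ab => /addrI ->.
Qed.

Lemma xi_teich : xi \in T.
Proof.
have e : (2 ^ s = (2 ^ s - 1).+1)%N by rewrite subn1 prednK ?expn_gt0.
by rewrite teichE [in xi ^+ _]e exprS (prim_expr_order hxi) mulr1.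
Qed.

Lemma xiX_neq0 k : xi ^+ k != 0.
Proof.
apply/eqP => x0; have := prim_expr_order hxi => h.
have : xi ^+ k ^+ (2 ^ s - 1) = 1 by rewrite exprAC h expr1n.
rewrite x0 expr0n; have := prim_order_gt0 hxi; case: (2 ^ s - 1)%N => //= n _.
by move/esym/eqP; rewrite oner_eq0.
Qed.

Definition teich_list : {set R} :=
  0 |: [set xi ^+ (i : nat) | i : 'I_(2 ^ s - 1)].

Lemma card_teich_list : #|teich_list| = (2 ^ s)%N.
Proof.
rewrite cardsU1 card_imset ?card_ord; last first.
  move=> i j /eqP; rewrite (eq_prim_root_expr hxi) !modn_small // => /eqP.
  exact: val_inj.
case: imsetP => [[i _ /esym/eqP]|_]; first by rewrite (negPf (xiX_neq0 _)).
by rewrite /= addnC subnK // expn_gt0.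
Qed.

Lemma teich_list_sub : teich_list \subset T.
Proof.
apply/subsetP=> x; rewrite in_setU1 => /predU1P[->|/imsetP[i _ ->]].
  exact: teich0.
by rewrite teichX // xi_teich.
Qed.

Lemma card_teich : #|T| = (2 ^ s)%N.
Proof.
have [_ hc _] := hR.
apply/eqP; rewrite eqn_leq -{2}card_teich_list (subset_leq_card teich_list_sub).
rewrite andbT -(leq_pmul2r (expn_gt0 2 s)) -{1}card_even_part -cardsX.
rewrite -(card_in_imset teich_even_inj) -expnMn -hc.
exact: max_card.
Qed.

Lemma teich_cases x : x \in T -> x = 0 \/ exists i : 'I_(2 ^ s - 1), x = xi ^+ i.
Proof.
have <- : teich_list = T.
  by apply/eqP; rewrite eqEcard teich_list_sub card_teich card_teich_list leqnn.
rewrite in_setU1 => /predU1P[->|/imsetP[i _ ->]]; first by left.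
by right; exists i.
Qed.

Lemma teich_decomp a :
  exists a0 a1, [/\ a0 \in T, a1 \in T & a = a0 + 2%:R * a1].
Proof.
have [_ hc _] := hR.
have ex b : exists2 b0, b0 \in T & exists z, b = b0 + 2%:R * z.
  have : b \in [set u.1 + u.2 | u in setX T even_part].
    suff -> : [set u.1 + u.2 | u in setX T even_part] = setT by rewrite inE.
    apply/eqP; rewrite eqEcard subsetT (card_in_imset teich_even_inj) cardsX.
    by rewrite cardsT hc card_teich card_even_part -expnMn leqnn.
  case/imsetP=> -[b0 p] /setXP[/= b0T]; rewrite inE => /eqP p0 ->.
  by have [z ->] := dbl_eq0_half p0; exists b0 => //; exists z.
have [a0 a0T [z ->]] := ex a; have [a1 a1T [w ->]] := ex z.
exists a0, a1; split=> //.
by rewrite mulrDr mulrA -natrM GR4_four addr0.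
Qed.

Lemma teich_decomp_inj a0 a1 b0 b1 :
  a0 \in T -> a1 \in T -> b0 \in T -> b1 \in T ->
  a0 + 2%:R * a1 = b0 + 2%:R * b1 -> a0 = b0 /\ a1 = b1.
Proof.
move=> a0T a1T b0T b1T e.
have ab : a0 = b0.
  apply: teich_inj => //; move: (congr1 ( *%R 2%:R) e).
  by rewrite !mulrDr !mulrA -natrM !GR4_four !addr0.
by split=> //; apply: teich_inj => //; move: e; rewrite ab => /addrI.
Qed.

Lemma teich_reg x y : x \in T -> x != 0 -> x * y = 0 -> y = 0.
Proof.
move=> xT x0; apply: dbl_reg; apply: contraNneq x0 => h.
by apply/eqP; apply: teich_inj => //; rewrite ?teich0 // h mulr0.
Qed.

(** * Frobenius and the trace *)

Lemma frobeniusE a0 a1 : a0 \in T -> a1 \in T ->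
  phi (a0 + 2%:R * a1) = a0 ^+ 2 + 2%:R * a1 ^+ 2.
Proof.
move=> a0T a1T; rewrite /frobenius; case: pickP => [b|] /=.
  case/exists_inP=> b0 b0T /exists_inP[b1 b1T /andP[/eqP e /eqP ->]].
  by have [-> ->] := teich_decomp_inj a0T a1T b0T b1T e.
move/(_ (a0 ^+ 2 + 2%:R * a1 ^+ 2))/negbT/negP; case.
by apply/exists_inP; exists a0 => //; apply/exists_inP; exists a1; rewrite ?eqxx.
Qed.

(** If a0 + b0 has Teichmuller part c0, then c0 = (a0 + b0)^(2^s), which is
    a0 + b0 + 2 m with m^2 = a0 b0; the carry -2 m = 2 m goes into c1, and the
    two resulting terms 2 m^2 and 2 a0 b0 cancel. *)
Lemma frobeniusD (a b : R) : phi (a + b) = phi a + phi b.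
Proof.
have [c0 [c1 [c0T c1T ec]]] := teich_decomp (a + b).
have [a0 [a1 [a0T a1T ea]]] := teich_decomp a.
have [b0 [b1 [b0T b1T eb]]] := teich_decomp b.
rewrite ec ea eb !frobeniusE //.
have ec2 : 2%:R * c0 = 2%:R * (a0 + b0).
  move: (congr1 ( *%R 2%:R) ec); rewrite ea eb !mulrDr !mulrA -natrM !GR4_four.
  by rewrite !addr0.
set m := (a0 * b0) ^+ q.
have m2 : m ^+ 2 = a0 * b0 by rewrite teich_q ?teichM.
have c0E : c0 = a0 + b0 + 2%:R * m.
  by rewrite -teich_add_pow // -{1}(teich_pow c0T); apply: dbl_pow2.
have c1E : 2%:R * c1 = 2%:R * (a1 + b1 + m).
  apply: (addrI c0); rewrite -ec ea eb [in RHS]c0E.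
  rewrite -[LHS]addr0 -(GR4_four m); ring.
rewrite (dbl_sqr c1E) (dbl_sqr ec2).
transitivity (a0 ^+ 2 + 2%:R * a1 ^+ 2 + (b0 ^+ 2 + 2%:R * b1 ^+ 2)
  + (2%:R * (a0 * b0) + 2%:R * m ^+ 2) + 4%:R * (a1 * b1 + a1 * m + b1 * m)).
  by ring.
rewrite m2 GR4_four addr0.
have -> : 2%:R * (a0 * b0) + 2%:R * (a0 * b0) = 4%:R * (a0 * b0) by ring.
by rewrite GR4_four addr0.
Qed.

Lemma frobenius0 : phi 0 = 0 :> R.
Proof. by apply: (addrI (phi 0)); rewrite -frobeniusD !addr0. Qed.

Lemma iter_frobeniusE k a0 a1 : a0 \in T -> a1 \in T ->
  iter k phi (a0 + 2%:R * a1) = a0 ^+ (2 ^ k) + 2%:R * a1 ^+ (2 ^ k).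
Proof.
move=> a0T a1T; elim: k => [//|k IH].
by rewrite iterS IH frobeniusE ?teichX // -!exprM -expnSr.
Qed.

Lemma iter_frobeniusD k (a b : R) : iter k phi (a + b) =
  iter k phi a + iter k phi b :> R.
Proof. by elim: k => [//|k IH]; rewrite !iterS IH frobeniusD. Qed.

Lemma traceRD (a b : R) : traceR s (a + b) = traceR s a + traceR s b :> R.
Proof.
by rewrite /traceR -big_split; apply: eq_bigr => i _; rewrite iter_frobeniusD.
Qed.

Lemma traceR0 : traceR s 0 = 0 :> R.
Proof. by apply: (addrI (traceR s 0)); rewrite -traceRD !addr0. Qed.

Lemma traceR_natmul (a : R) k : traceR s (k%:R * a) = k%:R * traceR s a :> R.
Proof.
elim: k => [|k IH]; first by rewrite !mul0r traceR0.
by rewrite -!natr1 !mulrDl !mul1r traceRD IH.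
Qed.

Lemma traceR_sum (I : finType) (F : I -> R) :
  traceR s (\sum_i F i) = \sum_i traceR s (F i).
Proof.
exact: (big_morph (@traceR s R) traceRD traceR0).
Qed.

(** Frobenius permutes the summands cyclically, as
    its s-th power is the identity. *)
Lemma traceR_frobenius (a : R) : phi (traceR s a) = traceR s a.
Proof.
rewrite /traceR (big_morph phi frobeniusD frobenius0).
have [a0 [a1 [a0T a1T ea]]] := teich_decomp a.
have iters : iter s phi a = a.
  by rewrite ea iter_frobeniusE // !teich_pow.
under eq_bigr do rewrite -iterS.
case: s s_gt0 iters => // k _ iters.
by rewrite big_ord_recr /= -iterS iters big_ord_recl /= addrC.
Qed.

(** A fixed point has a0^2 = a0 and a1^2 = a1, so both are 0 or 1: the fixed
    ring is the prime ring. *)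
Lemma frobenius_fixed (a : R) : phi a = a -> exists k : 'Z_4, (k : nat)%:R = a.
Proof.
have [a0 [a1 [a0T a1T ->]]] := teich_decomp a.
rewrite frobeniusE // => /teich_decomp_inj[]; rewrite ?teichX //.
have idem x : x \in T -> x ^+ 2 = x -> x = 0 \/ x = 1.
  move=> xT x2; have [->|x0] := eqVneq x 0; [by left | right].
  apply/eqP; rewrite -subr_eq0; apply/eqP; apply: (teich_reg xT x0).
  by rewrite mulrBr -expr2 x2 mulr1 subrr.
case/(idem _ a0T)=> ->; case/(idem _ a1T)=> ->.
- by exists (@Ordinal 4 0 isT); rewrite /=; ring.
- by exists (@Ordinal 4 2 isT); rewrite /=; ring.
- by exists (@Ordinal 4 1 isT); rewrite /=; ring.
- by exists (@Ordinal 4 3 isT); rewrite /=; ring.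
Qed.

Lemma traceE (a : R) : (trace s a : nat)%:R = traceR s a.
Proof.
rewrite /trace; case: pickP => [k /eqP //|] /=.
have [k hk] := frobenius_fixed (traceR_frobenius a).
by move/(_ k); rewrite hk eqxx.
Qed.

(** The sum is annihilated by xi^k - 1, which is nonzero modulo 2, hence not a
    zero divisor. *)
Lemma xi_geom_sum k : ~~ (2 ^ s - 1 %| k)%N ->
  \sum_(j < 2 ^ s - 1) (xi ^+ k) ^+ j = 0.
Proof.
move=> hk; apply: (@dbl_reg (xi ^+ k - 1)).
  rewrite mulrBr subr_eq0; apply: contra hk => /eqP/teich_inj e.
  by rewrite (prim_order_dvd hxi) e ?teich1 ?teichX ?xi_teich.
by rewrite -GRing.subrX1 exprAC (prim_expr_order hxi) expr1n subrr.
Qed.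

(** The trace does not vanish on 2R.  Otherwise, multiplying
    Tr(2 xi^j) = sum_i 2 xi^(j 2^i) by xi^(-j) and summing over j leaves only the
    term i = 0 by [xi_geom_sum], that is, 2 (2^s - 1) = -2 = 0. *)
Lemma traceR_dbl_xi : exists j, traceR s (2%:R * xi ^+ j) != 0.
Proof.
set n := (2 ^ s - 1)%N.
case: (boolP [exists j : 'I_n, traceR s (2%:R * xi ^+ j) != 0]).
  by case/existsP=> j hj; exists j.
rewrite negb_exists => /forallP h.
suff : 2%:R = 0 :> R by move/eqP; rewrite (negPf GR4_two_neq0).
have tr j : traceR s (2%:R * xi ^+ j) = \sum_(i < s) 2%:R * (xi ^+ j) ^+ (2 ^ i).
  apply: eq_bigr => i _; rewrite -[2%:R * _]add0r iter_frobeniusE ?teich0 //.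
    by rewrite expr0n expn_eq0 add0r.
  by rewrite teichX // xi_teich.
have n0 : (0 < n)%N by apply: (prim_order_gt0 hxi).
have nE : n.+1 = (2 ^ s)%N by rewrite /n -addn1 subnK // expn_gt0.
(* The factor xi^(j (n - 1)) stands for the inverse of xi^j. *)
have : \sum_(j < n) (xi ^+ j) ^+ n.-1 *
   \sum_(i < s) 2%:R * (xi ^+ j) ^+ (2 ^ i) = 0 :> R.
  by apply: big1 => j _; rewrite -tr; have /negPn/eqP-> := h j; rewrite mulr0.
under eq_bigr do rewrite mulr_sumr.
rewrite exchange_big /=.
have term (i : 'I_s) :
   \sum_(j < n) (xi ^+ j) ^+ n.-1 * (2%:R * (xi ^+ j) ^+ (2 ^ i))
   = 2%:R * \sum_(j < n) (xi ^+ (n.-1 + 2 ^ i)) ^+ j.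
  by rewrite mulr_sumr; apply: eq_bigr => j _; rewrite mulrCA -exprD exprAC.
under eq_bigr do rewrite term.
case: s s_gt0 nE term {h tr} => // k _ nE _.
rewrite big_ord_recl /= [X in _ + X]big1 => [|i _].
  rewrite addr0 addn1 prednK // (prim_expr_order hxi).
  under eq_bigr do rewrite expr1n.
  rewrite sumr_const card_ord -[_ *+ n]mulr_natr mul1r -natrM => e.
  have := GR4_four (2 ^ k)%:R; rewrite -natrM.
  have -> : (4 * 2 ^ k = 2 * n + 2)%N by rewrite -[n]/(n.+1.-1) nE expnS; lia.
  by rewrite natrD e add0r.
rewrite xi_geom_sum ?mulr0 //.
have m2 : (2 <= 2 ^ bump 0 i)%N by rewrite -{1}[2%N]expn1 leq_exp2l.
have mn : (2 ^ bump 0 i <= n)%N.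
  rewrite -ltnS nE ltn_exp2l //; exact: ltn_ord.
have -> : (n.-1 + 2 ^ bump 0 i = n + (2 ^ bump 0 i).-1)%N by lia.
by rewrite dvdn_addr ?dvdnn // gtnNdvd; lia.
Qed.

(** * Sums of Teichmuller elements *)

Lemma teich_opp x : x \in T -> - x \in T -> x = 0.
Proof.
move=> xT nxT; have e : - x = x.
  apply: teich_inj => //; apply/eqP; rewrite mulrN eq_sym -addr_eq0 -mulrDl -natrD.
  by rewrite GR4_four.
by apply: teich_inj; rewrite ?teich0 // mulr0 mulr_natl mulr2n -{1}e addNr.
Qed.

Lemma dbl_teich_pow (a : R) : 2%:R * a ^+ (2 ^ s) = 2%:R * a.
Proof.
have [a0 [a1 [a0T _ ->]]] := teich_decomp a.
have e : 2%:R * (a0 + 2%:R * a1) = 2%:R * a0.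
  by rewrite mulrDr mulrA -natrM GR4_four addr0.
by rewrite (dbl_expn _ e) e teich_pow.
Qed.

(** For odd s, 2^(s+1) - 1 is a multiple 3 m of 3, and a^(3 m) =
    a^(2^s) a^(2^s - 1) is congruent to a: the m-th power inverts cubing in the
    residue field. *)
Lemma dbl_cube_inj (a b : R) : odd s ->
  2%:R * a ^+ 3 = 2%:R * b ^+ 3 -> 2%:R * a = 2%:R * b.
Proof.
move=> s_odd ab.
have [m hm] : exists m, (3 * m + 1 = 2 ^ s + 2 ^ s)%N.
  rewrite -(odd_double_half s) s_odd -mul2n expnD expnM.
  elim: (s./2) => [|k [m hm]]; first by exists 1%N.
  by exists (4 * m + 1)%N; move: hm; rewrite (expnS (2 ^ 2)); lia.
have cube (x : R) : 2%:R * x = 2%:R * x ^+ 3 ^+ m.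
  have -> : x ^+ 3 ^+ m = x ^+ (2 ^ s) * x ^+ (2 ^ s).-1.
    by rewrite -exprM -exprD; congr (_ ^+ _); have := expn_gt0 2 s; lia.
  by rewrite mulrA dbl_teich_pow -mulrA -exprS prednK ?expn_gt0 // dbl_teich_pow.
by rewrite (cube a) (cube b) (dbl_expn m ab).
Qed.

Lemma dbl_pow_eq0 (u : R) k : 2%:R * u ^+ k = 0 -> 2%:R * u = 0.
Proof.
elim: k => [|k IH]; first by rewrite expr0 mulr1 => /eqP; rewrite (negPf GR4_two_neq0).
by rewrite exprS => /dbl_prime[].
Qed.

(** The 2^s-th power of x + y = x' + y' gives x y = x' y', so x is a root of
    (X - x') (X - y'), and one of the two factors vanishes at x because a
    nonzero difference of elements of T is not a zero divisor. *)
Lemma teich_pair x y x' y' : x \in T -> y \in T -> x' \in T -> y' \in T ->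
  x + y = x' + y' -> x = x' \/ x = y'.
Proof.
move=> xT yT x'T y'T e.
have exy : x * y = x' * y'.
  rewrite -[LHS]teich_q ?teichM // -[RHS]teich_q ?teichM //; apply: dbl_sqr.
  by apply: (addrI (x + y)); rewrite -teich_add_pow // {2}e -teich_add_pow // e.
have [h|h] := eqVneq (2%:R * (x - x')) 0.
  by left; apply: teich_inj => //; apply/eqP; rewrite -subr_eq0 -mulrBr h.
right; apply/eqP; rewrite -subr_eq0; apply/eqP; apply: (dbl_reg h).
transitivity (x ^+ 2 - x * (x' + y') + x' * y'); first by ring.
by rewrite -e -exy; ring.
Qed.

(** The 2^s-th power of x + y + z + w = 0 shows that the second elementary
    symmetric function e2 of x, y, z, w is even.  Eliminating w, e2 is
    congruent to a^2 + a b + b^2 with a = x + z and b = y + z; as this divides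
    a^3 - b^3, injectivity of cubing makes a and b even. *)
Lemma teich_sum4 x y z w : odd s ->
  x \in T -> y \in T -> z \in T -> w \in T -> x + y + z + w = 0 -> x = y.
Proof.
move=> s_odd xT yT zT wT e0.
have e2 : 2%:R * (x * y + z * w + (x + y) * (z + w)) = 0.
  apply: (@dbl_pow_eq0 _ q).
  (* The three q-th powers come from x + y, from z + w and from their sum. *)
  have := pow2_add (x + y) (z + w) s.-1.
  rewrite prednK // addrA e0 expr0n expn_eq0 /= !teich_add_pow // => e.
  rewrite dbl_pow2_add mulrDr dbl_pow2_add -mulrDr [RHS]e -[LHS]add0r -{1}e0; ring.
set a := x + z; set b := y + z.
have ab : 2%:R * (a ^+ 2 + a * b + b ^+ 2) = 0.
  have wE : w = - (x + y + z) by apply/eqP; rewrite -addr_eq0 addrC e0.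
  rewrite -[LHS]addr0 -{1}e2 wE /a /b.
  by rewrite -[RHS](GR4_four (z ^+ 2 + x * z + y * z)); ring.
have eab : 2%:R * a = 2%:R * b.
  apply: (dbl_cube_inj s_odd); apply/eqP; rewrite -subr_eq0; apply/eqP.
  transitivity (2%:R * (a ^+ 2 + a * b + b ^+ 2) * (a - b)); first by ring.
  by rewrite ab mul0r.
have a0 : 2%:R * a = 0.
  apply: (@dbl_pow_eq0 _ 2).
  have eb2 := dbl_sqr eab.
  have : 2%:R * a ^+ 2 + 2%:R * b * a + 2%:R * b ^+ 2 = 0 by rewrite -[RHS]ab; ring.
  rewrite -eab -eb2 => h; rewrite -[RHS]h -[LHS]addr0 -(GR4_four (a ^+ 2)); ring.
have cong u : u \in T -> 2%:R * (u + z) = 0 -> u = z.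
  move=> uT h; apply: teich_inj => //; apply: (addIr (2%:R * z)).
  by rewrite -mulrDr h -mulrDl -natrD GR4_four.
by rewrite (cong x) // (cong y) // -eab.
Qed.

Local Open Scope nat_scope.

(** * Counting representations *)

Lemma sum_bool_le1 (I : finType) (P : pred I) :
  (forall x y, P x -> P y -> x = y) -> \sum_x (P x : nat) <= 1.
Proof.
move=> h; rewrite -big_mkcond sum1_card; apply/card_le1_eqP => x y.
by rewrite !unfold_in => Px Py; apply: h.
Qed.

Lemma sum_teich : \sum_(e : R) ((e \in T) : nat) = 2 ^ s.
Proof. by rewrite -big_mkcond sum1_card card_teich. Qed.

Lemma eq_of_sum_leq (I : finType) (f g : I -> nat) :
  (forall i, f i <= g i) -> \sum_i f i = \sum_i g i -> forall i, f i = g i.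
Proof.
move=> le_fg /eqP; have lef i : true -> f i <= g i ?= iff (f i == g i).
  by move=> _; split.
rewrite (leqif_sum lef) => /forall_inP h i; exact/eqP/h.
Qed.

Definition sum_count (d : R) :=
  \sum_(e : R) ((e \in T) && ((d - e)%R \in T) : nat).
Definition diff_count (d : R) :=
  \sum_(e : R) ((e \in T) && ((e - d)%R \in T) : nat).

Lemma total_sum_count : \sum_d sum_count d = 2 ^ s * 2 ^ s.
Proof.
rewrite exchange_big /= -{1}sum_teich big_distrl /=; apply: eq_bigr => e _.
rewrite (reindex_inj (addIr e)) /= -sum_teich big_distrr /=.
by apply: eq_bigr => d _; rewrite addrK mulnb.
Qed.

Lemma total_diff_count : \sum_d diff_count d = 2 ^ s * 2 ^ s.
Proof.
rewrite exchange_big /= -{1}sum_teich big_distrl /=; apply: eq_bigr => e _.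
rewrite (reindex_inj (subrI e)) /= -sum_teich big_distrr /=.
by apply: eq_bigr => d _; rewrite subKr mulnb.
Qed.

Lemma diff_count_le d :
  diff_count d + (2%:R * d == 0)%R <= 2 ^ s * (d == 0%R) + 1.
Proof.
have [->|d0] := eqVneq d 0%R.
  rewrite mulr0 eqxx muln1 leq_add2r -sum_teich; apply: leq_sum => e _.
  by rewrite subr0 andbb.
rewrite muln0 add0n; have [d2|d2] := eqVneq.
  rewrite addn1 ltnS leqn0 sum_nat_eq0; apply/forallP => e /=.
  rewrite eqb0; apply/negP => /andP[eT fT]; move/eqP: d0; apply.
  have h : e = (e - d)%R by apply: teich_inj; rewrite // mulrBr d2 subr0.
  by rewrite -[d](subKr e) -h subrr.
rewrite addn0; apply: sum_bool_le1 => e f /andP[eT e'T] /andP[fT f'T].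
have [|//|h] := @teich_pair e (f - d)%R f (e - d)%R eT f'T fT e'T; first by ring.
by case/eqP: d0; rewrite -[d](subKr e) -h subrr.
Qed.

Lemma diff_countE d : diff_count d + (2%:R * d == 0)%R = 2 ^ s * (d == 0%R) + 1.
Proof.
have [_ hc _] := hR; move: d; apply: eq_of_sum_leq diff_count_le _.
rewrite !big_split /= total_diff_count sum1_card -big_distrr /=.
rewrite -[in LHS]big_mkcond -[in RHS]big_mkcond !sum1_card.
rewrite hc (_ : #|_| = 2 ^ s); last first.
  by rewrite -card_even_part; apply: eq_card => x; rewrite !inE.
by rewrite (card1 (0%R : R)) muln1 -expnMn addnC.
Qed.

Lemma sum_count_le2 d : sum_count d <= 2.
Proof.
rewrite /sum_count -big_mkcond sum1_card.
case: (pickP (fun e => (e \in T) && ((d - e)%R \in T))) => [e /andP[eT e'T]|h].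
  apply: (@leq_trans #|[set e; (d - e)%R]|); last by rewrite cards2; case: eqP.
  apply/subset_leq_card/subsetP => f; rewrite -topredE /= => /andP[fT f'T].
  rewrite !inE; apply/orP.
  have [||] := @teich_pair f (d - f)%R e (d - e)%R fT f'T eT e'T; first by ring.
    by move/eqP; left.
  by move/eqP; right.
by rewrite eq_card0.
Qed.

Lemma sum_count_opp_le1 d e : odd s ->
  e \in T -> (- d - e)%R \in T -> sum_count d <= 1.
Proof.
move=> s_odd eT e'T; apply: sum_bool_le1 => x y /andP[xT x'T] /andP[yT y'T].
have half z : z \in T -> (d - z)%R \in T -> z = (d - z)%R.
  by move=> zT z'T; apply: (@teich_sum4 _ _ e (- d - e)%R) => //; ring.
apply: teich_inj => //.
rewrite !mulr_natl !mulr2n {2}(half x) // {2}(half y) //; ring.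
Qed.

(** By [teich_pair] each of the two counts is at most 2; if both are nonzero,
    [teich_sum4] allows only representations e + e, and each count is at most 1. *)
Lemma sum_countN_le d : odd s -> sum_count d + sum_count (- d)%R <= 2.
Proof.
move=> s_odd.
have empty c : (forall e, (e \in T) && ((c - e)%R \in T) = false) -> sum_count c = 0.
  by move=> h; rewrite /sum_count big1 // => e _; rewrite h.
case: (pickP (fun e => (e \in T) && ((d - e)%R \in T))) => [e /andP[eT e'T]|/empty->].
  2: exact: sum_count_le2.
case: (pickP (fun e => (e \in T) && ((- d - e)%R \in T))) => [f /andP[fT f'T]|/empty->].
  2: by rewrite addn0 sum_count_le2.
apply: (@leq_add _ _ 1 1); first exact: sum_count_opp_le1 s_odd fT f'T.
by apply: (sum_count_opp_le1 s_odd eT); rewrite opprK.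
Qed.

Lemma sum_opp (F : R -> nat) : \sum_e F (- e)%R = \sum_e F e.
Proof. by rewrite [RHS](reindex_inj (@oppr_inj R)). Qed.

Lemma sum_countNE d : odd s -> sum_count d + sum_count (- d)%R = 2.
Proof.
have [_ hc _] := hR.
move=> s_odd; move: d; apply: eq_of_sum_leq => [d|]; first exact: sum_countN_le.
rewrite big_split /= sum_opp total_sum_count.
by rewrite sum_nat_const hc -expnMn addnn -muln2.
Qed.

(** The coefficients of T + T^-; the value at 0 is 2. *)
Definition kerdock_mult (d : R) : nat := (d \in T) + ((- d)%R \in T).
Local Notation h := kerdock_mult.

Lemma sum_kerdock_mult : \sum_e h e = 2 * 2 ^ s.
Proof.
rewrite big_split /= sum_teich (sum_opp (fun e => (e \in T) : nat)).
by rewrite sum_teich addnn mul2n.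
Qed.

(** (T + T^-)^2 = 2^(s+1) [0] + 4 R - 2 P, coefficientwise. *)
Lemma kerdock_mult_conv d : odd s ->
  \sum_e h e * h (d - e)%R + 2 * (2%:R * d == 0)%R = 2 ^ s.+1 * (d == 0%R) + 4.
Proof.
move=> s_odd.
have -> : \sum_e h e * h (d - e)%R =
    (sum_count d + sum_count (- d)%R) + (diff_count d + diff_count d).
  have diff : \sum_e ((- e)%R \in T) * ((d - e)%R \in T) = diff_count d.
    rewrite (reindex_inj (subrI d)) /=; apply: eq_bigr => e _.
    by rewrite subKr opprB mulnb andbC.
  have sum : \sum_e ((- e)%R \in T) * ((e - d)%R \in T) = sum_count (- d)%R.
    rewrite (reindex_inj (@oppr_inj R)) /=; apply: eq_bigr => e _.
    by rewrite opprK [(- e - d)%R]addrC mulnb.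
  have split e : h e * h (d - e)%R =
      ((e \in T) && ((d - e)%R \in T)) + ((e \in T) && ((e - d)%R \in T))
      + (((- e)%R \in T) * ((d - e)%R \in T) + ((- e)%R \in T) * ((e - d)%R \in T)).
    by rewrite /h opprB mulnDl !mulnDr !mulnb.
  under eq_bigr do rewrite split.
  by rewrite !big_split /= diff sum [diff_count d + sum_count _]addnC addnACA.
rewrite sum_countNE //; have := diff_countE d; rewrite expnS -mulnA.
set X := 2 ^ s * _; set b := nat_of_bool _; clearbody X b; lia.
Qed.

Lemma teich_coset_unique c :
  \sum_(e : R) ((e \in T) * (2%:R * (c - e) == 0)%R) = 1.
Proof.
have [c0 [c1 [c0T _ ->]]] := teich_decomp c.
rewrite (bigD1 c0) //= c0T addrAC subrr add0r mulrA -natrM GR4_four eqxx big1 // => e ec.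
rewrite mulnb; apply/eqP; rewrite eqb0; apply: contra ec => /andP[eT /eqP he].
apply/eqP/teich_inj => //; apply/eqP; rewrite eq_sym -subr_eq0 -mulrBr.
by rewrite -[X in X == _]addr0 -{1}(GR4_four c1) -[X in _ == X]he; apply/eqP; ring.
Qed.

(** (T + T^-) P = 2 R, coefficientwise. *)
Lemma kerdock_mult_coset c : \sum_e h e * (2%:R * (c - e) == 0)%R = 2.
Proof.
rewrite /h; under eq_bigr do rewrite mulnDl.
rewrite big_split /= teich_coset_unique (reindex_inj (@oppr_inj R)) /=.
rewrite (eq_bigr (fun e => (e \in T) * (2%:R * (- c - e) == 0)%R)).
  by rewrite teich_coset_unique.
by move=> e _; rewrite !opprK -[(- c - e)%R]opprD mulrN oppr_eq0.
Qed.

Definition kerdock_cayley (x y : R) : nat := h (x - y)%R.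

Lemma kerdock_cayley_walk2 x y : odd s ->
  nwalks kerdock_cayley 2 x y + 2 * (2%:R * (x - y) == 0)%R
    = 2 ^ s.+1 * (x == y) + 4.
Proof.
move=> s_odd; rewrite -(subr_eq0 x) -(kerdock_mult_conv _ s_odd) /=; congr (_ + _).
rewrite (reindex_inj (subrI x)) /=; apply: eq_bigr => e _.
rewrite (bigD1 y) //= eqxx muln1 big1 => [|z /negPf->]; last by rewrite muln0.
by rewrite addn0 /kerdock_cayley subKr addrAC.
Qed.

(** The square of T + T^- times T + T^-, with the
    negative term moved to the left. *)
Lemma kerdock_cayley_walk3 x y : odd s ->
  nwalks kerdock_cayley 3 x y + 4
    = 2 ^ s.+1 * kerdock_cayley x y + 8 * 2 ^ s.
Proof.
move=> s_odd.
have coset : \sum_z kerdock_cayley x z * (2%:R * (z - y) == 0)%R = 2.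
  rewrite -[RHS](kerdock_mult_coset (x - y)) (reindex_inj (subrI x)) /=.
  by apply: eq_bigr => e _; rewrite /kerdock_cayley subKr addrAC.
have total : \sum_z kerdock_cayley x z = 2 * 2 ^ s.
  rewrite -[RHS]sum_kerdock_mult (reindex_inj (subrI x)) /=.
  by apply: eq_bigr => e _; rewrite /kerdock_cayley subKr.
have -> : nwalks kerdock_cayley 3 x y =
  \sum_z kerdock_cayley x z * nwalks kerdock_cayley 2 z y by [].
rewrite [4 in LHS](_ : _ = 2 * 2) // -[X in _ + 2 * X]coset big_distrr /= -big_split /=.
transitivity (\sum_z (2 ^ s.+1 * (kerdock_cayley x z * (z == y))
                      + 4 * kerdock_cayley x z)).
  apply: eq_bigr => z _; have := kerdock_cayley_walk2 z y s_odd.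
  set w := nwalks _ _ _ _ => hw.
  by rewrite [2 * _]mulnCA -mulnDr hw mulnDr mulnCA [4 * _]mulnC.
rewrite big_split /= -!big_distrr /= total (bigD1 y) //= eqxx muln1.
rewrite big1 => [|z /negPf->]; last by rewrite muln0.
lia.
Qed.

Local Close Scope nat_scope.

(** * Syndromes and the coset graph *)

(** Every nonzero ideal contains some 2 t with t a power of xi, hence
    all the 2 xi^j, and the trace is nonzero at one of these. *)
Lemma traceR_nondegenerate (x : R) : (forall a, traceR s (a * x) = 0) -> x = 0.
Proof.
move=> tr0; apply/eqP/negPn/negP => x0.
have [y [z [y0 yE trz]]] : exists y z : R, [/\ 2%:R * z != 0, y = 2%:R * z
   & forall a, traceR s (a * y) = 0].
  have [/dbl_eq0_half[z xE]|x2] := eqVneq (2%:R * x) 0.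
    by exists x, z; rewrite -xE.
  by exists (2%:R * x), x; split=> // a; rewrite mulrA.
have [t [t1 [tT _ zE]]] := teich_decomp z.
have yt : y = 2%:R * t.
  by rewrite yE zE mulrDr mulrA -natrM GR4_four addr0.
have [j] := traceR_dbl_xi.
case: (teich_cases tT) => [t0|[i ti]].
  by case/eqP: y0; rewrite -yE yt t0 mulr0.
suff <- : xi ^+ (j + (2 ^ s - 1 - i)) * y = 2%:R * xi ^+ j by rewrite trz eqxx.
rewrite yt ti mulrCA -exprD -addnA subnK ?(ltnW (ltn_ord i)) //.
by rewrite exprD (prim_expr_order hxi) mulr1.
Qed.

(** The embedding of 'Z_4 as the prime ring of R. *)
Definition Z4_cast (k : 'Z_4) : R := (k : nat)%:R.
Local Notation c := Z4_cast.

Lemma natr_mod4 m : (m %% 4)%:R = m%:R :> R.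
Proof. by rewrite [in RHS](divn_eq m 4) natrD natrM GR4_four0 mulr0 add0r. Qed.

Lemma Z4_castD a b : c (a + b) = c a + c b.
Proof. by rewrite /c /= natr_mod4 natrD. Qed.

Lemma Z4_castM a b : c (a * b) = c a * c b.
Proof. by rewrite /c /= natr_mod4 natrM. Qed.

Lemma Z4_cast0 : c 0 = 0. Proof. by []. Qed.

Lemma Z4_cast_eq0 a : c a = 0 -> a = 0.
Proof.
have [hch _ _] := hR; case: a => a a_lt4 /eqP; rewrite /c hch => a_dvd4.
by apply: val_inj => /=; rewrite -(modn_small a_lt4); apply/eqP.
Qed.

Lemma Z4_cast_sum (I : finType) (F : I -> 'Z_4) :
  c (\sum_i F i) = \sum_i c (F i).
Proof. exact: (big_morph c Z4_castD Z4_cast0). Qed.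

Local Notation n := (2 ^ s - 1)%N.
Local Notation C := (dual_code (Kminus s xi)).

Definition syndrome (v : 'rV['Z_4]_n) : R := \sum_i c (v 0 i) * xi ^+ i.

Lemma syndromeD v w : syndrome (v + w) = syndrome v + syndrome w.
Proof.
by rewrite -big_split; apply: eq_bigr => i _; rewrite mxE Z4_castD mulrDl.
Qed.

Lemma syndrome0 : syndrome 0 = 0.
Proof. by apply: (addrI (syndrome 0)); rewrite -syndromeD !addr0. Qed.

Lemma syndromeB v w : syndrome (v - w) = syndrome v - syndrome w.
Proof.
by apply: (addIr (syndrome w)); rewrite -syndromeD !subrK.
Qed.

Lemma syndromeZ u v : syndrome (u *: v) = c u * syndrome v.
Proof.
by rewrite mulr_sumr; apply: eq_bigr => i _; rewrite mxE Z4_castM mulrA.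
Qed.

Lemma syndrome_delta i : syndrome (delta_mx 0 i) = xi ^+ i.
Proof.
rewrite /syndrome (bigD1 i) //= mxE !eqxx big1 => [|j /negPf ji].
  by rewrite addr0 /c mul1r.
by rewrite mxE ji andbF /c mul0r.
Qed.

Lemma syndrome_surj r : exists v, syndrome v = r.
Proof.
have teich t : t \in T -> exists v, syndrome v = t.
  case/teich_cases => [->|[i ->]]; first by exists 0; apply: syndrome0.
  by exists (delta_mx 0 i); apply: syndrome_delta.
have [r0 [r1 [/teich[v0 <-] /teich[v1 <-] ->]]] := teich_decomp r.
by exists (v0 + 2%:R *: v1); rewrite syndromeD syndromeZ.
Qed.

(** The inner product of v with the codeword of a is Tr (a * syndrome v). *)
Lemma mem_dual_Kminus v : (v \in C) = (syndrome v == 0).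
Proof.
have inner a : c (\sum_i v 0 i * trace s (a * xi ^+ i)) = traceR s (a * syndrome v).
  rewrite Z4_cast_sum mulr_sumr traceR_sum; apply: eq_bigr => i _.
  by rewrite Z4_castM /c traceE -traceR_natmul mulrCA.
rewrite inE; apply/forall_inP/eqP => [vC|v0 w /imsetP[a _ ->]].
  apply: traceR_nondegenerate => a; rewrite -inner.
  suff -> : \sum_i v 0 i * trace s (a * xi ^+ i) = 0 by [].
  have aK : \row_(t < n) trace s (a * xi ^+ t) \in Kminus s xi by apply: imset_f.
  rewrite -[RHS](eqP (vC _ aK)).
  by apply: eq_bigr => i _; rewrite mxE.
apply/eqP/Z4_cast_eq0; rewrite -[RHS]traceR0 -(mulr0 a) -v0 -inner; congr c.
by apply: eq_bigr => i _; rewrite mxE.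
Qed.

Lemma mem_code_coset v w : (w \in code_coset C v) = (syndrome w == syndrome v).
Proof.
apply/imsetP/eqP => [[u]|vw].
  by rewrite mem_dual_Kminus => /eqP u0 ->; rewrite syndromeD u0 addr0.
exists (w - v); last by rewrite addrC subrK.
by rewrite mem_dual_Kminus syndromeB vw subrr.
Qed.

Lemma eq_code_coset v w :
  (code_coset C v == code_coset C w) = (syndrome v == syndrome w).
Proof.
apply/eqP/eqP => [e|e]; last by apply/setP => u; rewrite !mem_code_coset e.
by apply/eqP; rewrite -mem_code_coset -e mem_code_coset.
Qed.

Local Notation V := (coset_vertex C).

Lemma vertex_coset (X : V) : exists v, val X = code_coset C v.
Proof. by have /imsetP[v _ ->] := valP X; exists v. Qed.

(** Any vector of the coset has the same syndrome, so picking one is harmless. *)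
Definition vertex_syndrome (X : V) : R :=
  odflt 0 (omap syndrome [pick v in val X]).

Lemma vertex_syndromeE (X : V) v :
  val X = code_coset C v -> vertex_syndrome X = syndrome v.
Proof.
rewrite /vertex_syndrome => ->; case: pickP => [w|/(_ v)] /=.
  by rewrite mem_code_coset => /eqP.
by rewrite mem_code_coset eqxx.
Qed.

Lemma vertex_syndrome_inj : injective vertex_syndrome.
Proof.
move=> X Y; have [v vX] := vertex_coset X; have [w wY] := vertex_coset Y.
rewrite (vertex_syndromeE vX) (vertex_syndromeE wY) => e.
by apply: val_inj; rewrite vX wY; apply/eqP; rewrite eq_code_coset e.
Qed.

Lemma vertex_syndrome_bij : bijective vertex_syndrome.
Proof.
apply: (inj_card_bij vertex_syndrome_inj).
rewrite -(card_imset predT vertex_syndrome_inj); apply/subset_leq_card/subsetP => r _.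
have [v <-] := syndrome_surj r.
have vP : code_coset C v \in code_cosets C by apply: imset_f.
pose X : V := exist (fun X => X \in code_cosets C) _ vP.
by apply/imsetP; exists X => //; rewrite (@vertex_syndromeE X v).
Qed.

Lemma coset_diff v w :
  [set x - y | x in code_coset C v, y in code_coset C w] = code_coset C (v - w).
Proof.
apply/setP => u; rewrite mem_code_coset; apply/imset2P/eqP => [[x y]|uE].
  by rewrite !mem_code_coset => /eqP xv /eqP yw ->; rewrite !syndromeB xv yw.
exists (u + w) w; rewrite ?mem_code_coset ?addrK //.
by rewrite syndromeD uE syndromeB subrK.
Qed.

Lemma coset_adjE (X Y : V) (d := vertex_syndrome X - vertex_syndrome Y) :
  coset_adj X Y = (d != 0) && ((d \in T) || (- d \in T)).
Proof.
have [v vX] := vertex_coset X; have [w wY] := vertex_coset Y.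
have dE : d = syndrome (v - w).
  by rewrite /d (vertex_syndromeE vX) (vertex_syndromeE wY) syndromeB.
have c1 : c 1 = 1 by [].
have c3 : c 3%:R = -1.
  have : c (3%:R + 1) = c 0 by congr c; apply: val_inj.
  by rewrite Z4_castD c1 Z4_cast0 => /eqP; rewrite addr_eq0 => /eqP.
apply/existsP/andP => [[u /existsP[i /andP[u13]]]|[d0 dT]].
  rewrite vX wY coset_diff eq_code_coset -dE syndromeZ syndrome_delta => /eqP->.
  move: u13; rewrite in_cons mem_seq1 => /orP[] /eqP->.
    by rewrite c1 mul1r xiX_neq0 teichX ?xi_teich.
  by rewrite c3 mulN1r oppr_eq0 opprK xiX_neq0 teichX ?orbT ?xi_teich.
have [u [i [u13 e]]] : exists u : 'Z_4, exists i : 'I_n,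
    u \in [:: 1; 3%:R] /\ d = c u * xi ^+ i.
  case/orP: dT => /teich_cases[].
  - by move/eqP; rewrite (negPf d0).
  - by case=> i ->; exists 1, i; rewrite c1 mul1r.
  - by move/eqP; rewrite oppr_eq0 (negPf d0).
  case=> i e; exists 3%:R, i; split; first by rewrite !inE orbT.
  by rewrite c3 mulN1r -e opprK.
exists u; apply/existsP; exists i.
rewrite u13 vX wY coset_diff eq_code_coset syndromeZ syndrome_delta -dE.
exact/eqP.
Qed.

Lemma add_loops_cayley (X Y : V) : add_loops 2 (@coset_adj n C) X Y =
  kerdock_cayley (vertex_syndrome X) (vertex_syndrome Y).
Proof.
rewrite /add_loops coset_adjE /kerdock_cayley /h -(inj_eq vertex_syndrome_inj).
rewrite -(subr_eq0 (vertex_syndrome X)); set d := _ - _.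
have [->|d0] := eqVneq d 0; first by rewrite oppr0 teich0.
rewrite muln0 addn0 /=; case: (boolP (d \in T)) => dT; case: (boolP (- d \in T)) => ndT //.
by rewrite (teich_opp dT ndT) eqxx in d0.
Qed.
End GaloisRing.

Theorem mainTheorem4 (s : nat) (R : finComNzRingType) (xi : R)
    (hs3 : (3 <= s)%N) (hsodd : odd s) (hR : is_GR4 s R)
    (hxi : (2 ^ s - 1).-primitive_root%R xi) :
  is_SWRG 3 (add_loops 2 (@coset_adj _ (dual_code (Kminus s xi)))).
Proof.
have s0 : (0 < s)%N by apply: ltn_trans hs3.
exists (2 ^ s.+1 + (8 * 2 ^ s - 4))%N%:Z, (8 * 2 ^ s - 4)%N%:Z.
exists (2 * 2 ^ s.+1 + (8 * 2 ^ s - 4))%N%:Z => X Y.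
have cayley := add_loops_cayley s0 hR hxi.
rewrite (nwalks_bij 3 X Y (vertex_syndrome_bij s0 hR hxi) cayley).
have := kerdock_cayley_walk3 s0 hR hxi
  (vertex_syndrome X) (vertex_syndrome Y) hsodd.
rewrite -cayley; set w := nwalks _ _ _ _; rewrite /add_loops.
have := expn_gt0 2 s; set A := (2 ^ s.+1)%N; set B := (2 ^ s)%N => /= B0.
have self : coset_adj X X = false.
  by rewrite (coset_adjE s0 hR hxi) subrr eqxx.
have [<-|_] := eqVneq X Y; first by rewrite self => hw; congr Posz; lia.
by case: (coset_adj X Y) => /= hw; congr Posz; lia.
Qed.
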